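(* Let $\sigma>0$ be a constant, let $s\in\mathbb{C}$ with $\Re s>0$, put $S_x=1+\sigma/s$, and let $\gamma_x,\gamma_y\ge 0$ be real constants. Consider on the rectangle $[-x_0-\delta,x_0+\delta]\times[-y_0,y_0]$ the equation $$s^2\widehat{E}_z=\frac{1}{S_x}\frac{\partial}{\partial x}\left(\frac{1}{S_x}\frac{\partial\widehat{E}_z}{\partial x}\right)+\frac{\partial^2\widehat{E}_z}{\partial y^2}.$$ (a) Every solution $\widehat{E}_z\ne0$ subject to the boundary conditions $$\frac1s\left(\frac{1}{S_x}\frac{\partial\widehat{E}_z}{\partial x}\pm\gamma_x s\widehat{E}_z\right)=0\ \text{ at } x=\pm(x_0+\delta),\qquad \frac1s\left(\frac{\partial\widehat{E}_z}{\partial y}\pm\gamma_y s\widehat{E}_z\right)=0\ \text{ at } y=\pm y_0,$$ must satisfy $\widehat{\mathcal{E}}_\sigma(s)=0$. (b) Every solution $\widehat{E}_z\ne0$ subject to the boundary conditions $\widehat{E}_z=0$ at $x=\pm(x_0+\delta)$ and $\widehat{E}_z=0$ at $y=\pm y_0$ must satisfy $\widehat{\mathcal{E}}^0_\sigma(s)=0$. Here $\widehat{\mathcal{E}}_\sigma(s)$ and $\widehat{\mathcal{E}}^0_\sigma(s)$ are the energies of $\widehat{E}_z$ defined in the context.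
   Context: $x_0,y_0,\delta>0$. $\widehat{E}_z=\widehat{E}_z(x,y)$ is complex-valued and sufficiently smooth up to the boundary (e.g. $C^2$) for the equation, boundary conditions and integration by parts to make sense. $\|\cdot\|$ is the $L^2$ norm on the rectangle. $\Gamma_x=\{x:-x_0-\delta\le x\le x_0+\delta\}$, $\Gamma_y=\{y:-y_0\le y\le y_0\}$; $\|\cdot\|_{\Gamma_x}$, $\|\cdot\|_{\Gamma_y}$ are the $L^2$ norms on these intervals; $\widehat{E}_z(\pm y_0)$ denotes the trace on $y=\pm y_0$ (a function of $x$) and $\widehat{E}_z(\pm(x_0+\delta))$ the trace on $x=\pm(x_0+\delta)$ (a function of $y$). The superscript $^*$ is complex conjugation. The energies are $$\widehat{\mathcal{E}}_\sigma(s)=\Re s\,\|s\widehat{E}_z\|^2+\Re\left(\frac{(sS_x)^*}{S_x}\right)\left\|\frac{1}{S_x}\frac{\partial\widehat{E}_z}{\partial x}\right\|^2+\Re s\left\|\frac{\partial\widehat{E}_z}{\partial y}\right\|^2+\gamma_y\left(\|s\widehat{E}_z(y_0)\|^2_{\Gamma_x}+\|s\widehat{E}_z(-y_0)\|^2_{\Gamma_x}\right)+\gamma_x\Re\left(\frac{1}{S_x}\right)\left(\|s\widehat{E}_z(x_0+\delta)\|^2_{\Gamma_y}+\|s\widehat{E}_z(-x_0-\delta)\|^2_{\Gamma_y}\right),$$ $$\widehat{\mathcal{E}}^0_\sigma(s)=\Re s\,\|s\widehat{E}_z\|^2+\Re\left(\frac{(sS_x)^*}{S_x}\right)\left\|\frac{1}{S_x}\frac{\partial\widehat{E}_z}{\partial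 x}\right\|^2+\Re s\left\|\frac{\partial\widehat{E}_z}{\partial y}\right\|^2.$$ *)

(* Defs.v *)
From HB Require Import structures.
From mathcomp Require Import all_boot all_order all_algebra.
From mathcomp Require Import complex.
From mathcomp Require Import all_classical all_reals all_analysis.

Set Implicit Arguments.
Unset Strict Implicit.
Unset Printing Implicit Defensive.

Import Order.TTheory GRing.Theory Num.Theory.
Import numFieldNormedType.Exports.

Local Open Scope classical_set_scope.
Local Open Scope complex_scope.
Local Open Scope ring_scope.

(* The topology of [R[i]] is the one defined by its modulus. *)
HB.instance Definition _ (R : realType) :=
  PseudoPointedMetric.copy R[i] (R[i] : numClosedFieldType)^o.
HB.instance Definition _ (R : realType) :=
  NormedModule.copy R[i] (R[i] : numClosedFieldType)^o.

(* Complex-valued functions of a real variable, differentiated relatively to a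
   set [I]: for [I] a segment this is the usual derivative at interior points
   and the one-sided derivative at the end points. *)
Definition diff_quotient (R : realType) (f : R -> R[i]) (x y : R) : R[i] :=
  (f y - f x) / (y - x)%:C.

Definition derivable_in (R : realType) (I : set R) (f : R -> R[i]) (x : R) :
    Prop :=
  cvg (diff_quotient f x y @[y --> within I x^']).

Definition deriv_in (R : realType) (I : set R) (f : R -> R[i]) (x : R) : R[i] :=
  lim (diff_quotient f x y @[y --> within I x^']).

Definition partial_x (R : realType) (I : set R) (f : R * R -> R[i])
    (p : R * R) : R[i] :=
  deriv_in I (fun x => f (x, p.2)) p.1.

Definition partial_y (R : realType) (J : set R) (f : R * R -> R[i])
    (p : R * R) : R[i] :=
  deriv_in J (fun y => f (p.1, y)) p.2.

(* Continuous differentiability up to the boundary of [I `*` J]. *)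
Definition C1_on (R : realType) (I J : set R) (f : R * R -> R[i]) : Prop :=
  [/\ {within I `*` J, continuous f},
      forall p, (I `*` J) p ->
        derivable_in I (fun x => f (x, p.2)) p.1 /\
        derivable_in J (fun y => f (p.1, y)) p.2,
      {within I `*` J, continuous (partial_x I f)} &
      {within I `*` J, continuous (partial_y J f)}].

Definition C2_on (R : realType) (I J : set R) (f : R * R -> R[i]) : Prop :=
  [/\ C1_on I J f, C1_on I J (partial_x I f) & C1_on I J (partial_y J f)].

Definition L2norm (d : measure_display) (T : measurableType d) (R : realType)
    (mu : {measure set T -> \bar R}) (D : set T) (f : T -> R[i]) : R :=
  Num.sqrt (\int[mu]_(t in D) ((Normc.normc (f t)) ^+ 2)).

Definition L2norm_itv (R : realType) (I : set R) (f : R -> R[i]) : R :=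
  L2norm (@lebesgue_measure R) I f.

Definition L2norm_rect (R : realType) (I J : set R) (f : R * R -> R[i]) : R :=
  L2norm ((@lebesgue_measure R) \x (@lebesgue_measure R))%E (I `*` J) f.

Definition Gamma_x (R : realType) (x0 delta : R) : set R :=
  `[- (x0 + delta), x0 + delta].

Definition Gamma_y (R : realType) (y0 : R) : set R := `[- y0, y0].

Definition stretch (R : realType) (sigma : R) (s : R[i]) : R[i] :=
  1 + sigma%:C / s.

Definition pml_equation (R : realType) (x0 y0 delta sigma : R) (s : R[i])
    (E : R * R -> R[i]) : Prop :=
  let I := Gamma_x x0 delta in
  let J := Gamma_y y0 in
  let Sx := stretch sigma s in
  forall p, (I `*` J) p ->
    s ^+ 2 * E p =
      1 / Sx * partial_x I (fun q => 1 / Sx * partial_x I E q) p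
      + partial_y J (partial_y J E) p.

Definition impedance_bc (R : realType) (x0 y0 delta sigma gammax gammay : R)
    (s : R[i]) (E : R * R -> R[i]) : Prop :=
  let I := Gamma_x x0 delta in
  let J := Gamma_y y0 in
  let Sx := stretch sigma s in
  let a := x0 + delta in
  [/\ forall y, J y ->
        1 / s * (1 / Sx * partial_x I E (a, y)
                 + gammax%:C * s * E (a, y)) = 0,
      forall y, J y ->
        1 / s * (1 / Sx * partial_x I E (- a, y)
                 - gammax%:C * s * E (- a, y)) = 0,
      forall x, I x ->
        1 / s * (partial_y J E (x, y0) + gammay%:C * s * E (x, y0)) = 0 &
      forall x, I x ->
        1 / s * (partial_y J E (x, - y0) - gammay%:C * s * E (x, - y0)) = 0].

Definition dirichlet_bc (R : realType) (x0 y0 delta : R)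
    (E : R * R -> R[i]) : Prop :=
  [/\ forall y, Gamma_y y0 y -> E (x0 + delta, y) = 0,
      forall y, Gamma_y y0 y -> E (- (x0 + delta), y) = 0,
      forall x, Gamma_x x0 delta x -> E (x, y0) = 0 &
      forall x, Gamma_x x0 delta x -> E (x, - y0) = 0].

Definition energy0 (R : realType) (x0 y0 delta sigma : R) (s : R[i])
    (E : R * R -> R[i]) : R :=
  let I := Gamma_x x0 delta in
  let J := Gamma_y y0 in
  let Sx := stretch sigma s in
  complex.Re s * L2norm_rect I J (fun p => s * E p) ^+ 2
  + complex.Re ((s * Sx)^* / Sx)
    * L2norm_rect I J (fun p => 1 / Sx * partial_x I E p) ^+ 2
  + complex.Re s * L2norm_rect I J (partial_y J E) ^+ 2.

Definition energy (R : realType) (x0 y0 delta sigma gammax gammay : R)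
    (s : R[i]) (E : R * R -> R[i]) : R :=
  let I := Gamma_x x0 delta in
  let J := Gamma_y y0 in
  let Sx := stretch sigma s in
  let a := x0 + delta in
  energy0 x0 y0 delta sigma s E
  + gammay * (L2norm_itv I (fun x => s * E (x, y0)) ^+ 2
              + L2norm_itv I (fun x => s * E (x, - y0)) ^+ 2)
  + gammax * complex.Re (1 / Sx)
    * (L2norm_itv J (fun y => s * E (a, y)) ^+ 2
       + L2norm_itv J (fun y => s * E (- a, y)) ^+ 2).

(* Main.v *)
Require Import Defs.
From mathcomp Require Import all_boot all_order all_algebra.
From mathcomp Require Import complex.
From mathcomp Require Import all_classical all_reals all_analysis.
From mathcomp Require Import ring lra.

Set Implicit Arguments.
Unset Strict Implicit.
Unset Printing Implicit Defensive.

Import Order.TTheory GRing.Theory Num.Theory.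
Import numFieldNormedType.Exports.

Local Open Scope classical_set_scope.
Local Open Scope complex_scope.
Local Open Scope ring_scope.

(** The energy identity is the real part of the equation tested against
    (s E)^*, integrated over the rectangle.  Write k = 1 / S_x and let E_x, E_y
    be the partial derivatives of E.  Multiplying the equation
    s^2 E = k^2 E_xx + E_yy by s^* E^* and adding to both sides
    s^* k^2 |E_x|^2 + s^* |E_y|^2 turns the right-hand side into a divergence,

      s |s E|^2 + s^* k^2 |E_x|^2 + s^* |E_y|^2
        = d/dx (s^* k^2 E^* E_x) + d/dy (s^* E^* E_y),

    because d/dx (E^* E_x) = |E_x|^2 + E^* E_xx and similarly in y.  As
    s^* k^2 |E_x|^2 = ((s S_x)^* / S_x) |k E_x|^2, the real part of the
    left-hand side is the density of the energy without boundary terms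
    ([energy_density]).  Integrating, that energy equals the flux of the two
    fields through the four sides ([energy0_boundary]).  Homogeneous Dirichlet
    data kill this flux; impedance data turn it into minus the boundary terms
    of the full energy ([impedance_flux]).  Hence both energies vanish.

    The analysis behind the integration by parts is elementary, since
    everything is continuous up to the boundary.  Only fields of the form
    Re (c f^* h) are differentiated, so the product rule and the fundamental
    theorem of calculus are applied to a real function on each horizontal and
    vertical segment ([integral_pairing]); one-sided derivatives at the end
    points enter through continuity only.  Fubini's theorem then gives the
    two-dimensional identities ([green_x], [green_y]); its integrability
    hypothesis holds because a function continuous on a compact rectangle is
    bounded, and measurable for the product sigma-algebra
    ([open_measurable_prod]). *)

Local Notation mu := lebesgue_measure.
Local Notation mu2 R := ((@mu R) \x (@mu R))%E.

(** * Continuous functions on a rectangle are integrable *)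

(** The plane has a countable basis of open boxes, those with rational end
    points, so that the product sigma-algebra contains all open sets. *)
Lemma open_measurable_prod (R : realType) (O : set (R * R)) : open O ->
  measurable (O : set (measurableTypeR R * measurableTypeR R)).
Proof.
move=> oO.
pose box (t : (rat * rat) * (rat * rat)) : set (R * R) :=
  `]ratr t.1.1, ratr t.1.2[%classic `*`
  `]ratr t.2.1, ratr t.2.2[%classic.
pose sub t := if `[< box t `<=` O >] then box t else set0.
have -> : O = \bigcup_t sub t.
  apply/seteqP; split => [p Op|p [t _]]; last first.
    by rewrite /sub; case: asboolP => // + bp; apply.
  have [[A B] [/nbhs_ballP[a a0 aA] /nbhs_ballP[b b0 bB]] ABO] :
    nbhs p O by exact: open_nbhs_nbhs.
  have rats (x r : R) : 0 < r -> exists t : rat * rat,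
      `]ratr t.1, ratr t.2[%classic x /\
      `]ratr t.1, ratr t.2[%classic `<=` ball x r.
    move=> r0; have [|l] := @rat_in_itvoo R (x - r) x; first by lra.
    have [|u] := @rat_in_itvoo R x (x + r); first by lra.
    rewrite !in_itv /= => /andP[xu ur] /andP[rl lx].
    exists (l, u); rewrite /= in_itv/= lx xu; split => // z /=.
    rewrite in_itv/= /ball/= => /andP[lz zu].
    by rewrite ltr_distlC; apply/andP; split; lra.
  have [t1 [pt1 t1A]] := rats p.1 _ a0.
  have [t2 [pt2 t2B]] := rats p.2 _ b0.
  exists (t1, t2) => //; rewrite /sub; case: asboolP => [_|[]]; first by split.
  by move=> q [q1 q2]; apply: ABO; split => /=;
    [apply: aA; exact: t1A|apply: bB; exact: t2B].
apply: countable_bigcupT_measurable => // t; rewrite /sub.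
by case: asboolP => _ //; apply: measurableX; exact: measurable_itv.
Qed.

Lemma continuous_rect_measurable (R : realType) (D : set (R * R))
    (f : R * R -> R) :
  measurable (D : set (measurableTypeR R * measurableTypeR R)) ->
  {within D, continuous f} ->
  measurable_fun (D : set (measurableTypeR R * measurableTypeR R)) f.
Proof.
move=> mD /continuousP cf.
apply: (measurability _ (measurable_realfun.RGenOpens.measurableE R)).
move=> _ [_ [a [b ->] <-]].
have /cf/open_subspaceP[V oV /= eV] : open (`]a, b[%classic : set R)
  by exact: interval_open.
by rewrite setIC -eV; apply: measurableI => //; exact: open_measurable_prod.
Qed.

(** Compactness of the rectangle makes [f] bounded, and its area is finite. *)
Lemma continuous_rect_integrable (R : realType) (a b c d : R)
    (f : R * R -> R) :
  {within `[a, b] `*` `[c, d], continuous f} ->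
  (mu2 R).-integrable (`[a, b] `*` `[c, d]) (EFin \o f).
Proof.
move=> cf.
have mD : measurable (`[a, b] `*` `[c, d] :
    set (measurableTypeR R * measurableTypeR R)).
  by apply: measurableX; exact: measurable_itv.
have fin (x y : R) : (@lebesgue_measure R `[x, y] < +oo)%E.
  by rewrite lebesgue_measure_itv/=; case: ifP; rewrite // -EFinB ltry.
apply: measurable_bounded_integrable => //.
- have E := @product_measure1E _ _ _ _ R (@lebesgue_measure R)
    (@lebesgue_measure R) _ _ (measurable_itv `[a, b]) (measurable_itv `[c, d]).
  rewrite [ltLHS]E lte_mul_pinfty//.
    by rewrite ge0_fin_numE//; exact: fin.
  exact: fin.
- exact: continuous_rect_measurable.
have : bounded_set (f @` (`[a, b] `*` `[c, d])).
  apply: compact_bounded; apply: continuous_compact => //.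
  by apply: compact_setX; exact: segment_compact.
move=> [M [Mr fM]]; exists M; split => // x Mx p Dp /=.
by apply: fM => //; exists p.
Qed.

(** * Continuity of real and imaginary parts and of hermitian products *)

Lemma normc_ge_Im (R : realType) (z : R[i]) : `|complex.Im z|%:C <= `|z|.
Proof.
by case: z => a b; simpc; rewrite -sqrtr_sqr ler_wsqrtr // lerDr sqr_ge0.
Qed.

Lemma cvg_Re (R : realType) (T : Type) (F : set_system T) (f : T -> R[i])
    (l : R[i]) : Filter F ->
  f @ F --> l -> (fun t => complex.Re (f t)) @ F --> complex.Re l.
Proof.
move=> FF /cvgrPdist_lt fl; apply/cvgrPdist_lt => e e0.
have := fl e%:C; rewrite ltcR => /(_ e0); apply: filterS => t.
by move=> H; rewrite -ltcR -raddfB; exact: le_lt_trans (normc_ge_Re _) H.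
Qed.

Lemma cvg_Im (R : realType) (T : Type) (F : set_system T) (f : T -> R[i])
    (l : R[i]) : Filter F ->
  f @ F --> l -> (fun t => complex.Im (f t)) @ F --> complex.Im l.
Proof.
move=> FF /cvgrPdist_lt fl; apply/cvgrPdist_lt => e e0.
have := fl e%:C; rewrite ltcR => /(_ e0); apply: filterS => t.
by move=> H; rewrite -ltcR -raddfB; exact: le_lt_trans (normc_ge_Im _) H.
Qed.

(** Conjugation preserves the modulus. *)
Lemma cvg_conjc (R : realType) (T : Type) (F : set_system T) (f : T -> R[i])
    (l : R[i]) : Filter F ->
  f @ F --> l -> (fun t => (f t)^*) @ F --> l^*.
Proof.
move=> FF /cvgrPdist_lt fl; apply/cvgrPdist_lt => e e0.
by apply: filterS (fl e e0) => t; rewrite -rmorphB normcJ.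
Qed.

(** All integrands met below, squared moduli included, are sums of terms
    Re (c f^* h). *)
Lemma within_continuous_Re_pairing (R : realType) (T : topologicalType)
    (D : set T) (c : R[i]) (f h : T -> R[i]) :
  {within D, continuous f} -> {within D, continuous h} ->
  {within D, continuous (fun p => complex.Re (c * ((f p)^* * h p)))}.
Proof.
move=> /subspace_continuousP cf /subspace_continuousP ch.
apply/subspace_continuousP => p Dp; apply: cvg_Re.
apply: cvgM; first exact: cvg_cst.
by apply: cvgM; [apply: cvg_conjc; exact: cf|exact: ch].
Qed.

(** With [df] and [dh] the derivatives of [f] and [h], this is the derivative
    of Re (c f^* h), the integrand in the integrations by parts. *)
Lemma within_continuous_Re_pairing_leibniz (R : realType) (T : topologicalType)
    (D : set T) (c : R[i]) (f h df dh : T -> R[i]) :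
  {within D, continuous f} -> {within D, continuous h} ->
  {within D, continuous df} -> {within D, continuous dh} ->
  {within D, continuous
    (fun p => complex.Re (c * ((df p)^* * h p + (f p)^* * dh p)))}.
Proof.
move=> cf ch cdf cdh.
have -> : (fun p => complex.Re (c * ((df p)^* * h p + (f p)^* * dh p))) =
    (fun p => complex.Re (c * ((df p)^* * h p))
              + complex.Re (c * ((f p)^* * dh p))).
  by apply/funext => p; rewrite mulrDr raddfD.
by move=> p; apply: cvgD; apply: within_continuous_Re_pairing.
Qed.

Lemma within_continuous_slice_x (R : realType) (T : topologicalType)
    (I J : set R) (F : R * R -> T) (y : R) : J y ->
  {within I `*` J, continuous F} ->
  {within I, continuous (fun x => F (x, y))}.
Proof.
move=> Jy /subspace_continuousP cF; apply/subspace_continuousP => x Ix.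
have toIJ : (fun t => (t, y)) @ within I (nbhs x) `=>`
    within (I `*` J) (nbhs (x, y)).
  move=> A [[U V] /= [Ux Vy] UVA]; rewrite /within/=.
  apply: filterS Ux => t Ut It; apply: (UVA (t, y)) => //=.
  by split => //=; exact: nbhs_singleton.
exact: cvg_comp toIJ (cF (x, y) (conj Ix Jy)).
Qed.

Lemma within_continuous_slice_y (R : realType) (T : topologicalType)
    (I J : set R) (F : R * R -> T) (x : R) : I x ->
  {within I `*` J, continuous F} ->
  {within J, continuous (fun y => F (x, y))}.
Proof.
move=> Ix /subspace_continuousP cF; apply/subspace_continuousP => y Jy.
have toIJ : (fun t => (x, t)) @ within J (nbhs y) `=>`
    within (I `*` J) (nbhs (x, y)).
  move=> A [[U V] /= [Ux Vy] UVA]; rewrite /within/=.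
  apply: filterS Vy => t Vt It; apply: (UVA (x, t)) => //=.
  by split => //=; exact: nbhs_singleton.
exact: cvg_comp toIJ (cF (x, y) (conj Ix Jy)).
Qed.

(** * Differentiation and integration of Re (c f^* h) on a segment *)

Lemma is_derive_of_quotient (R : realType) (g : R -> R) (x l : R) :
  (g y - g x) / (y - x) @[y --> x^'] --> l -> is_derive x 1 g l.
Proof.
move=> gl.
have H : h^-1 *: ((g \o shift x) (h *: 1) - g x) @[h --> 0^'] --> l.
  apply/cvgrPdist_lt => e e0.
  move/cvgrPdist_lt/(_ e e0): gl; rewrite near_withinE.
  move=> /nbhs_ballP[d /= d0 dP]; rewrite near_withinE.
  apply/nbhs_ballP; exists d => //= h; rewrite /ball/= sub0r normrN => hd h0.
  have := dP (h + x).
  rewrite /ball/= opprD addrCA subrr addr0 normrN => /(_ hd).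
  rewrite -subr_eq0 addrK => /(_ h0); rewrite /= /shift/=.
  by rewrite [h%:A]mulr1 [h^-1 *: _]mulrC.
by apply: DeriveDef; [apply/cvg_ex; exists l|apply: cvg_lim].
Qed.

(** Near an interior point all points belong to the segment, so the derivative
    relative to the segment is the two-sided one; real and imaginary parts then
    commute with the limit because they are continuous and real linear. *)
Lemma is_derive_Re (R : realType) (a b x : R) (f : R -> R[i]) :
  x \in `]a, b[ -> derivable_in `[a, b] f x ->
  is_derive x 1 (fun t => complex.Re (f t))
    (complex.Re (deriv_in `[a, b] f x)) /\
  is_derive x 1 (fun t => complex.Im (f t))
    (complex.Im (deriv_in `[a, b] f x)).
Proof.
move=> xab fx.
have df : diff_quotient f x y @[y --> x^'] --> deriv_in `[a, b] f x.
  have toI : x^' `=>` within `[a, b] x^'.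
    move=> A; rewrite /within/= => AI.
    have nI : \forall y \near x, y \in `]a, b[ by exact: near_in_itvoo.
    have nI' : \forall y \near x^', y \in `]a, b[ by apply: nbhs_dnbhs.
    by apply: filterS2 AI nI' => y + yab; apply; exact: subset_itv_oo_cc.
  exact: cvg_trans (cvg_app _ toI) fx.
have dqE t : diff_quotient f x t = (f t - f x) * ((t - x)^-1)%:C.
  by rewrite /diff_quotient -fmorphV.
split; apply: is_derive_of_quotient.
  have -> : (fun y => (complex.Re (f y) - complex.Re (f x)) / (y - x)) =
            (fun y => complex.Re (diff_quotient f x y)).
    apply/funext => t; rewrite dqE; case: (f t) (f x) => ? ? [? ?] /=.
    by rewrite mulr0 subr0.
  exact: cvg_Re.
have -> : (fun y => (complex.Im (f y) - complex.Im (f x)) / (y - x)) =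
          (fun y => complex.Im (diff_quotient f x y)).
  apply/funext => t; rewrite dqE; case: (f t) (f x) => ? ? [? ?] /=.
  by rewrite mulr0 add0r.
exact: cvg_Im.
Qed.

(** Segments have no isolated point; this is what makes the limits defining
    [deriv_in] unique at the end points as well. *)
Lemma within_itv_dnbhs_proper (R : realType) (a b x : R) : a < b ->
  `[a, b]%classic x -> ProperFilter (within `[a, b] x^').
Proof.
rewrite /= in_itv /= => ab /andP[ax xb].
apply: Build_ProperFilter_ex => A /= /nbhs_ballP[d /= d0 dA].
(* A nearby point of the segment lies to the right of x unless x = b. *)
have [xltb|blex] := ltP x b.
  pose y := x + Num.min (d / 2) (b - x).
  have m0 : 0 < Num.min (d / 2) (b - x).
    by rewrite lt_min; apply/andP; split; lra.
  have m1 : Num.min (d / 2) (b - x) <= d / 2 by rewrite ge_min lexx.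
  have m2 : Num.min (d / 2) (b - x) <= b - x by rewrite ge_min lexx orbT.
  exists y; apply: (dA y).
  - by rewrite /ball/= ltr_distlC /y; apply/andP; split; lra.
  - by rewrite /y; apply/eqP; lra.
  - by rewrite /= in_itv/= /y; apply/andP; split; lra.
pose y := x - Num.min (d / 2) (b - a).
have m0 : 0 < Num.min (d / 2) (b - a).
  by rewrite lt_min; apply/andP; split; lra.
have m1 : Num.min (d / 2) (b - a) <= d / 2 by rewrite ge_min lexx.
have m2 : Num.min (d / 2) (b - a) <= b - a by rewrite ge_min lexx orbT.
exists y; apply: (dA y).
- by rewrite /ball/= ltr_distlC /y; apply/andP; split; lra.
- by rewrite /y; apply/eqP; lra.
- by rewrite /= in_itv/= /y; apply/andP; split; lra.
Qed.

Lemma deriv_inZ (R : realType) (a b x : R) (k : R[i]) (f : R -> R[i]) :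
  a < b -> `[a, b]%classic x -> derivable_in `[a, b] f x ->
  deriv_in `[a, b] (fun t => k * f t) x = k * deriv_in `[a, b] f x.
Proof.
move=> ab xab fx; have PF := within_itv_dnbhs_proper ab xab.
apply: (cvg_lim (@norm_hausdorff _ _)).
have -> : diff_quotient (fun t => k * f t) x =
    (fun y => k * diff_quotient f x y).
  by apply/funext => y; rewrite /diff_quotient -mulrBr mulrA.
by apply: cvgMr; exact: fx.
Qed.

(** Conjugation is not complex linear, hence the product rule is applied to
    real and imaginary parts. *)
Lemma is_derive_Re_pairing (R : realType) (a b x : R) (c : R[i])
    (f h : R -> R[i]) :
  x \in `]a, b[ -> derivable_in `[a, b] f x -> derivable_in `[a, b] h x ->
  is_derive x 1 (fun t => complex.Re (c * ((f t)^* * h t)))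
    (complex.Re (c * ((deriv_in `[a, b] f x)^* * h x
                      + (f x)^* * deriv_in `[a, b] h x))).
Proof.
move=> xab /(is_derive_Re xab)[fr fi] /(is_derive_Re xab)[hr hi].
set u := (fun t => complex.Re (f t)) in fr.
set v := (fun t => complex.Im (f t)) in fi.
set p := (fun t => complex.Re (h t)) in hr.
set q := (fun t => complex.Im (h t)) in hi.
have -> : (fun t => complex.Re (c * ((f t)^* * h t))) =
    complex.Re c *: (u * p + v * q) - complex.Im c *: (u * q - v * p).
  apply/funext => t; rewrite !fctE /u /v /p /q.
  case: c (f t) (h t) => [c1 c2] [f1 f2] [h1 h2] /=.
  by rewrite /GRing.scale/=; ring.
have d1 := is_deriveD (is_deriveM fr hr) (is_deriveM fi hi).
have d2 := is_deriveB (is_deriveM fr hi) (is_deriveM fi hr).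
apply: is_derive_eq (is_deriveB (is_deriveZ (complex.Re c) d1)
                                (is_deriveZ (complex.Im c) d2)) _.
rewrite /u /v /p /q.
case: c (f x) (h x) (deriv_in _ f x) (deriv_in _ h x) =>
  [c1 c2] [f1 f2] [h1 h2] [f1' f2'] [h1' h2'] /=.
by rewrite /GRing.scale/=; ring.
Qed.

(** The fundamental theorem of calculus requires differentiability in the open
    interval and continuity up to its end points only. *)
Lemma integral_pairing (R : realType) (a b : R) (c : R[i])
    (f h : R -> R[i]) : a < b ->
  {within `[a, b], continuous f} -> {within `[a, b], continuous h} ->
  (forall x, `[a, b]%classic x ->
     derivable_in `[a, b] f x /\ derivable_in `[a, b] h x) ->
  {within `[a, b], continuous (deriv_in `[a, b] f)} ->
  {within `[a, b], continuous (deriv_in `[a, b] h)} ->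
  (\int[@lebesgue_measure R]_(x in `[a, b])
     (complex.Re (c * ((deriv_in `[a, b] f x)^* * h x
                      + (f x)^* * deriv_in `[a, b] h x)))%:E =
   (complex.Re (c * ((f b)^* * h b)) - complex.Re (c * ((f a)^* * h a)))%:E)%E.
Proof.
move=> ab cf ch dfh cdf cdh.
have cg := within_continuous_Re_pairing (c := c) cf ch.
rewrite EFinB.
apply: (continuous_FTC2 (F := fun x => complex.Re (c * ((f x)^* * h x)))) => //.
- by have := within_continuous_Re_pairing_leibniz (c := c) cf ch cdf cdh.
- have /(continuous_within_itvP _ ab)[_ cl cr] := cg.
  split => // x xab.
  have [dx hx] := dfh x (subset_itv_oo_cc xab).
  by have [] := is_derive_Re_pairing c xab dx hx.
- move=> x xab.
  have [dx hx] := dfh x (subset_itv_oo_cc xab).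
  by rewrite derive1E; have [] := is_derive_Re_pairing c xab dx hx.
Qed.

(** * Integration by parts on a rectangle *)

Section fubini_rectangle.
Variables (R : realType) (a b c d : R) (F : R * R -> R).
Hypothesis cF : {within `[a, b] `*` `[c, d], continuous F}.

Let f := (EFin \o F) \_ (`[a, b] `*` `[c, d]).

Let integrable_f : (mu2 R).-integrable setT f.
Proof.
apply/integrable_restrict => //.
  by apply: measurableX; exact: measurable_itv.
by rewrite setTI; exact: continuous_rect_integrable.
Qed.

Let integral_f :
  (\int[mu2 R]_p f p =
   \int[mu2 R]_(p in `[a, b] `*` `[c, d]) (F p)%:E)%E.
Proof.
by rewrite [RHS]integral_mkcond.
Qed.

(** Fubini's theorem for an integrand whose inner integrals are known: stating
    them in the extended reals spares a proof that they are finite. *)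
Lemma Rintegral_rect_y (G : R -> R) :
  (forall y, `[c, d]%classic y ->
     (\int[@mu R]_(x in `[a, b]) (F (x, y))%:E = (G y)%:E)%E) ->
  \int[mu2 R]_(p in `[a, b] `*` `[c, d]) F p =
  \int[@mu R]_(y in `[c, d]) G y.
Proof.
move=> FG; rewrite /Rintegral -integral_f -integral21_prod_meas1//.
congr fine; rewrite [RHS]integral_mkcond; apply: eq_integral => y _.
rewrite /fubini_G [RHS]patchE; case: ifPn => [|yJ].
  rewrite inE => yJ; rewrite /= -FG// [RHS]integral_mkcond.
  apply: eq_integral => x _; rewrite /f !patchE in_setX/=.
  by rewrite (mem_set yJ) andbT.
apply: integral0_eq => x _; rewrite /f patchE in_setX/=.
by rewrite (negbTE yJ) andbF.
Qed.

Lemma Rintegral_rect_x (G : R -> R) :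
  (forall x, `[a, b]%classic x ->
     (\int[@mu R]_(y in `[c, d]) (F (x, y))%:E = (G x)%:E)%E) ->
  \int[mu2 R]_(p in `[a, b] `*` `[c, d]) F p =
  \int[@mu R]_(x in `[a, b]) G x.
Proof.
move=> FG; rewrite /Rintegral -integral_f -integral12_prod_meas1//.
congr fine; rewrite [RHS]integral_mkcond; apply: eq_integral => x _.
rewrite /fubini_F [RHS]patchE; case: ifPn => [|xI].
  rewrite inE => xI; rewrite /= -FG// [RHS]integral_mkcond.
  apply: eq_integral => y _; rewrite /f !patchE in_setX/=.
  by rewrite (mem_set xI) andTb.
apply: integral0_eq => y _; rewrite /f patchE in_setX/=.
by rewrite (negbTE xI).
Qed.
End fubini_rectangle.

(** The one-dimensional integration by parts on the segment at height [y],
    integrated over [y]. *)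
Lemma green_x (R : realType) (a b c d : R) (k : R[i])
    (f h : R * R -> R[i]) : a < b ->
  C1_on `[a, b] `[c, d] f -> C1_on `[a, b] `[c, d] h ->
  \int[mu2 R]_(p in `[a, b] `*` `[c, d])
    complex.Re (k * ((partial_x `[a, b] f p)^* * h p
                     + (f p)^* * partial_x `[a, b] h p)) =
  \int[@mu R]_(y in `[c, d])
    (complex.Re (k * ((f (b, y))^* * h (b, y)))
     - complex.Re (k * ((f (a, y))^* * h (a, y)))).
Proof.
move=> ab [cf df cfx _] [ch dh chx _].
have cF := within_continuous_Re_pairing_leibniz (c := k) cf ch cfx chx.
apply: (Rintegral_rect_y cF) => y Jy.
apply: (@integral_pairing _ a b k
  (fun x => f (x, y)) (fun x => h (x, y))) => //.
- exact: within_continuous_slice_x cf.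
- exact: within_continuous_slice_x ch.
- move=> x Ix; have Dxy : (`[a, b] `*` `[c, d]) (x, y) by split.
  have [dfx _] := df _ Dxy; have [dhx _] := dh _ Dxy.
  by split; [exact: dfx|exact: dhx].
- exact: within_continuous_slice_x cfx.
- exact: within_continuous_slice_x chx.
Qed.

Lemma green_y (R : realType) (a b c d : R) (k : R[i])
    (f h : R * R -> R[i]) : c < d ->
  C1_on `[a, b] `[c, d] f -> C1_on `[a, b] `[c, d] h ->
  \int[mu2 R]_(p in `[a, b] `*` `[c, d])
    complex.Re (k * ((partial_y `[c, d] f p)^* * h p
                     + (f p)^* * partial_y `[c, d] h p)) =
  \int[@mu R]_(x in `[a, b])
    (complex.Re (k * ((f (x, d))^* * h (x, d)))
     - complex.Re (k * ((f (x, c))^* * h (x, c)))).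
Proof.
move=> cd [cf df _ cfy] [ch dh _ chy].
have cF := within_continuous_Re_pairing_leibniz (c := k) cf ch cfy chy.
apply: (Rintegral_rect_x cF) => x Ix.
apply: (@integral_pairing _ c d k
  (fun y => f (x, y)) (fun y => h (x, y))) => //.
- exact: within_continuous_slice_y cf.
- exact: within_continuous_slice_y ch.
- move=> y Jy; have Dxy : (`[a, b] `*` `[c, d]) (x, y) by split.
  have [_ dfy] := df _ Dxy; have [_ dhy] := dh _ Dxy.
  by split; [exact: dfy|exact: dhy].
- exact: within_continuous_slice_y cfy.
- exact: within_continuous_slice_y chy.
Qed.

(** * Squared moduli and the energy density *)

Lemma real_sqr_normcE (R : realType) (z : R[i]) :
  ((Normc.normc z) ^+ 2)%:C = z^* * z.
Proof.
case: z => x y; rewrite /= sqr_sqrtr ?addr_ge0 ?sqr_ge0//.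
by apply/eqP; rewrite eq_complex; apply/andP; split; apply/eqP => /=; ring.
Qed.

Lemma Re_mul_sqr_normc (R : realType) (c z : R[i]) :
  complex.Re c * (Normc.normc z) ^+ 2 = complex.Re (c * (z^* * z)).
Proof.
by rewrite -real_sqr_normcE; case: c => c1 c2 /=; rewrite mulr0 subr0.
Qed.

Lemma sqr_L2norm (d : measure_display) (T : measurableType d) (R : realType)
    (m : {measure set T -> \bar R}) (D : set T) (f : T -> R[i]) :
  L2norm m D f ^+ 2 = \int[m]_(t in D) ((Normc.normc (f t)) ^+ 2).
Proof. by rewrite sqr_sqrtr//; apply: Rintegral_ge0 => t _; exact: sqr_ge0. Qed.

Lemma within_continuous_sqr_normc (R : realType) (T : topologicalType)
    (D : set T) (f : T -> R[i]) : {within D, continuous f} ->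
  {within D, continuous (fun p => (Normc.normc (f p)) ^+ 2)}.
Proof.
move=> cf; have := within_continuous_Re_pairing (c := 1) cf cf.
under eq_fun do rewrite -Re_mul_sqr_normc mul1r.
by [].
Qed.

Lemma within_continuousZ (R : realType) (T : topologicalType)
    (D : set T) (k : R[i]) (f : T -> R[i]) : {within D, continuous f} ->
  {within D, continuous (fun p => k * f p)}.
Proof. by move=> cf x; apply: cvgMr; exact: cf. Qed.

(** S_x = (s + sigma) / s, and s + sigma has positive real part. *)
Lemma stretch_neq0 (R : realType) (sigma : R) (s : R[i]) :
  0 < sigma -> 0 < complex.Re s -> stretch sigma s != 0.
Proof.
move=> sigma0 s0.
have sN0 : s != 0 by apply/eqP => s_eq0; move: s0; rewrite s_eq0 ltxx.
rewrite /stretch -(divff sN0) -mulrDl mulf_neq0 ?invr_eq0//.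
apply/eqP => /(congr1 (@complex.Re R)); case: s s0 {sN0} => x y /= s0; lra.
Qed.

(** The equation is multiplied by s^* e^*.  The coefficient of |ex / S|^2
    comes from (s S)^* / S * |1 / S|^2 = s^* / S^2, and Re s = Re s^* allows
    s^* to be the coefficient of |ey|^2, as the flux in y requires. *)
Lemma energy_density (R : realType) (s S e ex exx ey eyy : R[i]) : S != 0 ->
  s ^+ 2 * e = 1 / S * (1 / S * exx) + eyy ->
  complex.Re s * (Normc.normc (s * e)) ^+ 2
  + complex.Re ((s * S)^* / S) * (Normc.normc (1 / S * ex)) ^+ 2
  + complex.Re s * (Normc.normc ey) ^+ 2 =
  complex.Re (s^* * (1 / S) ^+ 2 * (ex^* * ex + e^* * exx))
  + complex.Re (s^* * (ey^* * ey + e^* * eyy)).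
Proof.
move=> S0 eqe.
have -> : complex.Re s * (Normc.normc ey) ^+ 2 =
          complex.Re s^* * (Normc.normc ey) ^+ 2 by case: (s).
rewrite !Re_mul_sqr_normc -!raddfD; congr complex.Re.
(* Here s ^+ 2 * e appears, ready for the equation to be substituted. *)
have -> : s * ((s * e)^* * (s * e)) = s^* * e^* * (s ^+ 2 * e).
  by rewrite rmorphM; ring.
have -> : (s * S)^* / S * ((1 / S * ex)^* * (1 / S * ex)) =
          s^* * (1 / S) ^+ 2 * (ex^* * ex).
  have SJ0 : S^* != 0 by rewrite conjc_eq0.
  rewrite !rmorphM rmorph1 fmorphV.
  by field; rewrite SJ0 S0.
by rewrite eqe; ring.
Qed.

(** * Energies as boundary fluxes *)

Lemma partial_xZ (R : realType) (a b : R) (J : set R) (k : R[i])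
    (f : R * R -> R[i]) (p : R * R) : a < b -> (`[a, b] `*` J) p ->
  C1_on `[a, b] J f ->
  partial_x `[a, b] (fun q => k * f q) p = k * partial_x `[a, b] f p.
Proof.
move=> ab Dp [_ df _ _]; have [dfx _] := df _ Dp.
by case: Dp => Ip _; exact: deriv_inZ.
Qed.

(** Integral form of [energy_density]: the divergence on its right-hand side
    integrates to the outward flux through the four sides. *)
Lemma energy0_boundary (R : realType) (x0 y0 delta sigma : R) (s : R[i])
    (E : R * R -> R[i]) :
  0 < x0 + delta -> 0 < y0 -> stretch sigma s != 0 ->
  C2_on (Gamma_x x0 delta) (Gamma_y y0) E ->
  pml_equation x0 y0 delta sigma s E ->
  let I := Gamma_x x0 delta in
  let J := Gamma_y y0 in
  let a := x0 + delta in
  let flux_x p := complex.Re (s^* * (1 / stretch sigma s) ^+ 2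
                              * ((E p)^* * partial_x I E p)) in
  let flux_y p := complex.Re (s^* * ((E p)^* * partial_y J E p)) in
  energy0 x0 y0 delta sigma s E =
  \int[@mu R]_(y in J) (flux_x (a, y) - flux_x (- a, y))
  + \int[@mu R]_(x in I) (flux_y (x, y0) - flux_y (x, - y0)).
Proof.
move=> a_gt0 y0_gt0 S0 [C1E C1Ex C1Ey] pml I J a /=.
have ab : - a < a by rewrite /a; lra.
have cd : - y0 < y0 by lra.
have [cE _ cEx cEy] := C1E.
have [_ _ cExx _] := C1Ex; have [_ _ _ cEyy] := C1Ey.
rewrite -(green_x _ ab C1E C1Ex) -(green_y _ cd C1E C1Ey).
have mD : measurable (I `*` J : set (measurableTypeR R * measurableTypeR R)).
  by apply: measurableX; exact: measurable_itv.
rewrite /energy0 /L2norm_rect !sqr_L2norm.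
have iN (f : R * R -> R[i]) : {within I `*` J, continuous f} ->
    (mu2 R).-integrable (I `*` J)
      (EFin \o (fun p => (Normc.normc (f p)) ^+ 2)).
  by move=> cf; apply: continuous_rect_integrable;
    exact: within_continuous_sqr_normc.
have iN0 := iN _ (within_continuousZ (k := s) cE).
have iNx := iN _ (within_continuousZ (k := 1 / stretch sigma s) cEx).
have iNy := iN _ cEy.
have iZ (r : R) (f : R * R -> R) : (mu2 R).-integrable (I `*` J) (EFin \o f) ->
    (mu2 R).-integrable (I `*` J) (EFin \o (fun p => r * f p)).
  by move=> fi; exact: (integrableZl mD r fi).
have iD (f g : R * R -> R) : (mu2 R).-integrable (I `*` J) (EFin \o f) ->
    (mu2 R).-integrable (I `*` J) (EFin \o g) ->
    (mu2 R).-integrable (I `*` J) (EFin \o (fun p => f p + g p)).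
  by move=> fi gi; exact: (integrableD mD fi gi).
rewrite -!RintegralZl// -!RintegralD//; try exact: iZ; last 3 first.
- apply: continuous_rect_integrable.
  by have := within_continuous_Re_pairing_leibniz
    (c := s^* * (1 / stretch sigma s) ^+ 2) cE cEx cEx cExx.
- apply: continuous_rect_integrable.
  by have := within_continuous_Re_pairing_leibniz (c := s^*) cE cEy cEy cEyy.
- exact: iD (iZ _ _ iN0) (iZ _ _ iNx).
apply: eq_Rintegral => p; rewrite inE => Dp.
apply: energy_density => //.
by rewrite (pml p Dp) (partial_xZ _ _ Dp C1Ex).
Qed.

(** Collects the fluxes through two opposite sides, where [f] and [h] are the
    traces of s E on these sides. *)
Lemma Rintegral_impedance (R : realType) (a b k : R) (f h : R -> R[i])
    (F : R -> R) :
  {within `[a, b], continuous f} -> {within `[a, b], continuous h} ->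
  (forall x, `[a, b]%classic x ->
    F x = - (k * (Normc.normc (f x) ^+ 2 + Normc.normc (h x) ^+ 2))) ->
  \int[@mu R]_(x in `[a, b]) F x =
  - (k * (L2norm_itv `[a, b] f ^+ 2 + L2norm_itv `[a, b] h ^+ 2)).
Proof.
move=> cf ch Fx; rewrite /L2norm_itv !sqr_L2norm.
have mI : measurable (`[a, b] : set (measurableTypeR R)).
  exact: measurable_itv.
have iN (g : R -> R[i]) : {within `[a, b], continuous g} ->
    (@mu R).-integrable `[a, b] (EFin \o (fun x => (Normc.normc (g x)) ^+ 2)).
  move=> cg; apply: continuous_compact_integrable; first exact: segment_compact.
  by have := within_continuous_sqr_normc cg.
have iD : (@mu R).-integrable `[a, b]
    (EFin \o (fun x => (Normc.normc (f x)) ^+ 2 + (Normc.normc (h x)) ^+ 2)).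
  exact: (integrableD mI (iN _ cf) (iN _ ch)).
rewrite -RintegralD//; [|exact: iN|exact: iN].
rewrite -mulNr -RintegralZl//.
by apply: eq_Rintegral => x; rewrite inE => /Fx ->; rewrite mulNr.
Qed.

(** The boundary condition gives w = - gamma s e, the outward normal
    derivative in terms of the trace.  In the x direction w = E_x / S_x and
    k = 1 / S_x, in the y direction w = E_y and k = 1; the opposite side of
    each pair is covered by changing the sign of [gamma]. *)
Lemma impedance_flux (R : realType) (s k e w : R[i]) (gamma : R) : s != 0 ->
  1 / s * (w + gamma%:C * s * e) = 0 ->
  complex.Re (s^* * k * (e^* * w)) =
  - (gamma * complex.Re k * (Normc.normc (s * e)) ^+ 2).
Proof.
move=> s0 /eqP; rewrite mulf_eq0 mul1r invr_eq0 (negbTE s0) /= => bc.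
have -> : w = - gamma%:C * s * e.
  by move: bc; rewrite addr_eq0 => /eqP ->; rewrite !mulNr.
have -> : s^* * k * (e^* * (- gamma%:C * s * e)) =
          (- gamma)%:C * (k * ((s * e)^* * (s * e))).
  by rewrite rmorphN rmorphM; ring.
rewrite -mulrA Re_mul_sqr_normc -mulNr.
by case: (k * _) => x y /=; rewrite mul0r subr0.
Qed.

Theorem theorem4p4 (R : realType) (x0 y0 delta sigma gammax gammay : R)
    (s : R[i])
    (x0_gt0 : 0 < x0) (y0_gt0 : 0 < y0) (delta_gt0 : 0 < delta)
    (sigma_gt0 : 0 < sigma) (Re_s_gt0 : 0 < complex.Re s)
    (gammax_ge0 : 0 <= gammax) (gammay_ge0 : 0 <= gammay) :
  (forall E : R * R -> R[i],
     C2_on (Gamma_x x0 delta) (Gamma_y y0) E ->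
     (exists2 p, (Gamma_x x0 delta `*` Gamma_y y0) p & E p != 0) ->
     pml_equation x0 y0 delta sigma s E ->
     impedance_bc x0 y0 delta sigma gammax gammay s E ->
     energy x0 y0 delta sigma gammax gammay s E = 0)
  /\
  (forall E : R * R -> R[i],
     C2_on (Gamma_x x0 delta) (Gamma_y y0) E ->
     (exists2 p, (Gamma_x x0 delta `*` Gamma_y y0) p & E p != 0) ->
     pml_equation x0 y0 delta sigma s E ->
     dirichlet_bc x0 y0 delta E ->
     energy0 x0 y0 delta sigma s E = 0).
Proof.
have a_gt0 : 0 < x0 + delta by lra.
have S0 := stretch_neq0 sigma_gt0 Re_s_gt0.
have s0 : s != 0 by apply/eqP => s_eq0; move: Re_s_gt0; rewrite s_eq0 ltxx.
split => E C2E _ pml; last first.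
  move=> [Er El Et Eb]; rewrite (energy0_boundary a_gt0 y0_gt0 S0 C2E pml).
  have Rint0 (a b : R) (F : R -> R) :
      (forall x, `[a, b]%classic x -> F x = 0) ->
      \int[@lebesgue_measure R]_(x in `[a, b]) F x = 0.
    by move=> F0; rewrite /Rintegral integral0_eq// => x /F0 ->.
  rewrite !Rint0 ?addr0// => [x Ix|y Jy].
    by rewrite Et// Eb// rmorph0 !mul0r !mulr0 subr0.
  by rewrite Er// El// rmorph0 !mul0r !mulr0 subr0.
move=> [bcr bcl bct bcb].
have [[cE _ _ _] _ _] := C2E.
have Ia : Gamma_x x0 delta (x0 + delta) by rewrite /Gamma_x/= in_itv/=; lra.
have Ina : Gamma_x x0 delta (- (x0 + delta)).
  by rewrite /Gamma_x/= in_itv/=; lra.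
have Jb : Gamma_y y0 y0 by rewrite /Gamma_y/= in_itv/=; lra.
have Jnb : Gamma_y y0 (- y0) by rewrite /Gamma_y/= in_itv/=; lra.
rewrite /energy (energy0_boundary a_gt0 y0_gt0 S0 C2E pml).
rewrite (@Rintegral_impedance _ _ _ (gammax * complex.Re (1 / stretch sigma s))
  (fun y => s * E (x0 + delta, y)) (fun y => s * E (- (x0 + delta), y))).
- rewrite (@Rintegral_impedance _ _ _ gammay
    (fun x => s * E (x, y0)) (fun x => s * E (x, - y0))).
  + by rewrite addrAC -!addrA; ring.
  + exact/within_continuousZ/(within_continuous_slice_x Jb cE).
  + exact/within_continuousZ/(within_continuous_slice_x Jnb cE).
  + move=> x Ix.
    have top := impedance_flux 1 s0 (bct x Ix).
    have bot : 1 / s * (partial_y (Gamma_y y0) E (x, - y0)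
        + (- gammay)%:C * s * E (x, - y0)) = 0.
      by rewrite rmorphN !mulNr; exact: bcb.
    have {}bot := impedance_flux 1 s0 bot.
    move: top bot; rewrite !mulr1 => -> ->; ring.
- exact/within_continuousZ/(within_continuous_slice_y Ia cE).
- exact/within_continuousZ/(within_continuous_slice_y Ina cE).
- move=> y Jy; set k := 1 / _.
  have right := impedance_flux k s0 (bcr y Jy).
  have left : 1 / s * (k * partial_x (Gamma_x x0 delta) E (- (x0 + delta), y)
      + (- gammax)%:C * s * E (- (x0 + delta), y)) = 0.
    by rewrite rmorphN !mulNr; exact: bcl.
  have {}left := impedance_flux k s0 left.
  have assoc (e w : R[i]) :
      s^* * k ^+ 2 * (e^* * w) = s^* * k * (e^* * (k * w)).
    by ring.
  by rewrite !assoc left right; ring.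
Qed.
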